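(* Let $M$ be a ground conjunctive Markov logic network, and let $\lambda_1$ and $\lambda_2$ be possible worlds. If $\lambda_1\sim_M\lambda_2$, then $\Pr_M(\lambda_1)=\Pr_M(\lambda_2)$.
   Context: A ground conjunctive Markov logic network (ground cMLN) is a finite list $M$ of pairs $(F_j,w_j)$, where each $F_j$ is a conjunction of ground atoms and $w_j\in\mathbb R$, over a finite set $X$ of ground atoms (the Herbrand base). A (possible) world is a truth assignment $\lambda:X\to\{0,1\}$. $Sat(\lambda,M)$ is the set of formulas of $M$ satisfied by $\lambda$. Worlds are equivalent, $\lambda_1\sim_M\lambda_2$, iff $Sat(\lambda_1,M)=Sat(\lambda_2,M)$. The probability of a world is $\Pr_M(\lambda)=\frac1Z\exp\bigl(\sum_j w_j\, n_j(\lambda)\bigr)$, where $n_j(\lambda)=1$ if $\lambda$ satisfies the ground formula $F_j$ and $n_j(\lambda)=0$ otherwise, and $Z=\sum_{\lambda'}\exp\bigl(\sum_j w_j\, n_j(\lambda')\bigr)$, the sum being over all worlds $\lambda'$. *)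

(* Defs.v *)
From mathcomp Require Import all_boot all_order all_algebra.
From mathcomp Require Import classical_sets reals sequences.

Set Implicit Arguments.
Unset Strict Implicit.
Unset Printing Implicit Defensive.

Import Order.TTheory GRing.Theory Num.Theory.

Local Open Scope ring_scope.

(* [:: a_1; ...; a_k] stands for the conjunction a_1 /\ ... /\ a_k over the
   Herbrand base X; equality of formulas is syntactic, and the empty
   conjunction is allowed (it is true in every world). *)
Definition conj_formula (X : finType) : Type := seq X.

(* A list, so a formula may occur several times, with different weights. *)
Definition ground_cMLN (R : realType) (X : finType) : Type :=
  seq (conj_formula X * R).

Definition world (X : finType) : Type := {ffun X -> bool}.

Definition satisfies (X : finType) (lambda : world X) (F : conj_formula X) :
  bool := all (fun a : X => lambda a) F.

Definition Sat (R : realType) (X : finType) (lambda : world X)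
    (M : ground_cMLN R X) : set (conj_formula X) :=
  [set F : conj_formula X |
    (exists w : R, (F, w) \in M) /\ satisfies lambda F]%classic.

Definition world_equiv (R : realType) (X : finType) (M : ground_cMLN R X)
    (lambda1 lambda2 : world X) : Prop :=
  Sat lambda1 M = Sat lambda2 M.

Definition nsat (X : finType) (F : conj_formula X) (lambda : world X) : nat :=
  if satisfies lambda F then 1%N else 0%N.

Definition world_weight (R : realType) (X : finType) (M : ground_cMLN R X)
    (lambda : world X) : R :=
  expR (\sum_(Fw <- M) Fw.2 * (nsat Fw.1 lambda)%:R).

Definition partition_function (R : realType) (X : finType)
    (M : ground_cMLN R X) : R :=
  \sum_(lambda : world X) world_weight M lambda.

Definition Pr (R : realType) (X : finType) (M : ground_cMLN R X)
    (lambda : world X) : R :=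
  (partition_function M)^-1 * world_weight M lambda.

(* Main.v *)
Require Import Defs.
From mathcomp Require Import all_boot all_order all_algebra.
From mathcomp Require Import reals.

(** The normalising constant is common to all worlds, and the exponent depends only on which
    formulas of [M] hold. Equivalent worlds agree on each of these, so their exponents agree term by
    term. *)

Lemma world_equiv_satisfies (R : realType) (X : finType) (M : ground_cMLN R X)
    (lambda1 lambda2 : world X) (F : conj_formula X) (w : R) :
  world_equiv M lambda1 lambda2 -> (F, w) \in M ->
  satisfies lambda1 F = satisfies lambda2 F.
Proof.
move=> eqSat FwM.
(* The weight [w] witnesses that [F] occurs in [M], so only satisfaction remains. *)
have SatP lambda : Sat lambda M F <-> satisfies lambda F.
  by split=> [[]|satF] //; split=> //; exists w.
by apply/idP/idP=> /SatP; [rewrite eqSat | rewrite -eqSat] => /SatP.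
Qed.

Theorem theorem4 (R : realType) (X : finType) (M : ground_cMLN R X)
    (lambda1 lambda2 : world X) :
  world_equiv M lambda1 lambda2 -> Pr M lambda1 = Pr M lambda2.
Proof.
move=> eqSat; rewrite /Pr /world_weight; congr (_ * sequences.expR _)%R.
(* Agreement is known only for formulas of [M], so membership must be kept for each term. *)
apply: eq_big_seq => -[F w] FwM.
by rewrite /nsat (world_equiv_satisfies _ _ _ _ _ _ _ eqSat FwM).
Qed.
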